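(* There is a universal constant $c > 0$ such that for every $n \ge 1$, every $f : \{-1,1\}^n \to [0,1]$ and every $t > 0$, $$\mathbb{E}\, M(f_{Z_s}) \ge c\,(e^{2t} - 1)\, \mathrm{Var}(P_t f),$$ where $s = -\log(1 - e^{-t})$ and $Z_s$ is a random element of $\{-1,0,1\}^n$ with distribution $\mu_s^{\otimes n}$.
   Context: $\{-1,1\}^n$ carries the uniform probability measure, with respect to which $\mathrm{Var}$ and $\mathrm{Cov}$ of functions on the cube are taken. For $t \ge 0$, $P_t$ is the Bonami-Beckner semigroup: for $n=1$, $(P_{t,1} f)(x) = \mathbb{E} f + e^{-t}(f(x) - \mathbb{E} f)$, and in general $P_t = P_{t,1}^{\otimes n}$. $\mu_s = e^{-s}\delta_0 + \frac12(1-e^{-s})(\delta_1 + \delta_{-1})$ is a probability measure on $\{-1,0,1\}$. For $z \in \{-1,0,1\}^n$ and $x \in \{-1,1\}^n$, $z \oslash x \in \{-1,1\}^n$ is defined by $(z \oslash x)_i = x_i$ if $z_i = 0$ and $(z \oslash x)_i = z_i$ otherwise; the restriction $f_z$ is $f_z(x) = f(z \oslash x)$. A half-space in $\{-1,1\}^n$ is a set of the form $\{x \in \{-1,1\}^n: \langle x, a\rangle \le b\}$ with $a \in \mathbb{R}^n$, $b \in \mathbb{R}$. For $g : \{-1,1\}^n \to [0,1]$, $M(g) = \sup_A \mathrm{Cov}(1_A, g)$, the supremum over all half-spaces $A \subset \{-1,1\}^n$. *)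

(* Defs.v *)
From HB Require Import structures.
From mathcomp Require Import all_boot all_order all_algebra.
From mathcomp Require Import all_classical all_reals all_analysis.
From mathcomp Require Import ring lra.

Set Implicit Arguments.
Unset Strict Implicit.
Unset Printing Implicit Defensive.

Import Order.TTheory GRing.Theory Num.Theory.

Local Open Scope classical_set_scope.
Local Open Scope ring_scope.

(* The sign set {-1, 1} is encoded by bool, with true standing for 1 and false
   for -1; {-1, 0, 1} is encoded by option bool, with None standing for 0. *)
Definition cube (n : nat) := {ffun 'I_n -> bool}.
Definition tcube (n : nat) := {ffun 'I_n -> option bool}.

Definition sgnv (R : realType) (b : bool) : R := if b then 1 else -1.

(* Expectation, covariance and variance under the uniform probability measure
   on a finite type. *)
Definition mean (R : realType) (T : finType) (f : T -> R) : R :=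
  (\sum_(x : T) f x) / #|T|%:R.

Definition cov (R : realType) (T : finType) (f g : T -> R) : R :=
  mean (fun x => (f x - mean f) * (g x - mean g)).

Definition var (R : realType) (T : finType) (f : T -> R) : R := cov f f.

(* The n-th tensor power of an operator U on functions on {-1, 1}, acting on
   functions on the cube: expand f in the basis of point masses, which are
   tensor products of point masses on {-1, 1}, and apply U in each factor. *)
Definition tensor_pow (R : realType) (U : (bool -> R) -> bool -> R) (n : nat)
    (f : cube n -> R) (x : cube n) : R :=
  \sum_(y : cube n) f y * \prod_(i < n) U (fun b => (b == y i)%:R) (x i).

Definition bonami1 (R : realType) (t : R) (f : bool -> R) (b : bool) : R :=
  mean f + expR (- t) * (f b - mean f).

Definition bonami (R : realType) (n : nat) (t : R) : (cube n -> R) -> cube n -> R :=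
  tensor_pow (bonami1 t) (n := n).

Definition mu (R : realType) (s : R) (w : option bool) : R :=
  if w is Some _ then (1 - expR (- s)) / 2 else expR (- s).

Definition mu_mean (R : realType) (n : nat) (s : R) (h : tcube n -> R) : R :=
  \sum_(z : tcube n) (\prod_(i < n) mu s (z i)) * h z.

Definition oslash (n : nat) (z : tcube n) (x : cube n) : cube n :=
  [ffun i => if z i is Some b then b else x i].

Definition restr (R : realType) (n : nat) (f : cube n -> R) (z : tcube n)
    (x : cube n) : R := f (oslash z x).

Definition halfspace (R : realType) (n : nat) (A : {set cube n}) : Prop :=
  exists (a : 'rV[R]_n) (b : R),
    A = [set x : cube n | \sum_(i < n) sgnv R (x i) * a 0 i <= b]%SET.

(* [sup] is meaningful here: see [halfspace_cov_has_sup]. *)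
Definition M (R : realType) (n : nat) (g : cube n -> R) : R :=
  sup [set cov (fun x => (x \in A)%:R) g | A in [set A | halfspace R A]].

Lemma tensor_pow_prod (R : realType) (t : R) (n : nat)
    (g : 'I_n -> bool -> R) (x : cube n) :
  bonami t (fun y => \prod_(i < n) g i (y i)) x =
  \prod_(i < n) bonami1 t (g i) (x i).
Proof.
rewrite /bonami /tensor_pow.
under eq_bigr => y _ do rewrite -big_split /=.
rewrite -(bigA_distr_bigA (fun i b => g i b * bonami1 t (fun b' => (b' == b)%:R) (x i))).
apply: eq_bigr => i _; rewrite big_bool /= /bonami1 /mean !big_bool card_bool.
by case: (x i) => /=; field.
Qed.

Lemma halfspace_cov_has_sup (R : realType) (n : nat) (g : cube n -> R) :
  has_sup [set cov (fun x => (x \in A)%:R) g | A in [set A | halfspace R A]].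
Proof.
split.
  pose A0 := [set x : cube n | \sum_(i < n) sgnv R (x i) * (0 : 'rV[R]_n) 0 i <= 0]%SET.
  by exists (cov (fun x => (x \in A0)%:R) g), A0 => //; exists 0, 0.
exists (\sum_(A : {set cube n}) `|cov (fun x => (x \in A)%:R) g|) => _ [A _ <-].
rewrite (bigD1 A) //= (le_trans (ler_norm _)) // lerDl.
by apply: sumr_ge0 => B _; exact: normr_ge0.
Qed.

(* Main.v *)
Require Import Defs.
From HB Require Import structures.
From mathcomp Require Import all_boot all_order all_algebra.
From mathcomp Require Import all_classical all_reals all_analysis.
From mathcomp Require Import ring lra.

Set Implicit Arguments.
Unset Strict Implicit.
Unset Printing Implicit Defensive.

Import Order.TTheory GRing.Theory Num.Theory.

Local Open Scope ring_scope.

(** Write r = exp (- t); then s is chosen so that a coordinate stays free in the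
    random restriction with probability exp (- s) = 1 - r. The proof compares
    both sides with the degree-one Fourier weight
    W(g) = sum_i (E [g(x) x_i])^2 of the restricted functions.

    First, M(g) >= W(g) / 2 for every g with values in [0, 1] ([level1_le_M]).
    Let L be the degree-one part of g. Then Cov(L, g) = E L^2 = W(g). Clamp L to
    [-1/2, 1/2]: the clamped function is an average over an interval of length
    one of the indicators of the half-spaces {L >= c}, up to constants, so its
    covariance with g is at most M(g) ([layer_cake_le]). The part cut off is at
    most L^2 / 2 pointwise and costs at most W(g) / 2, because
    |g - E g| <= 1.

    Second, E W(f_Z) and Var(P_t f) are diagonal in the Walsh basis. A coefficient f^(S)
    contributes to the degree-one coefficient at i of a random restriction
    exactly when i is the only free element of S, so
    E W(f_Z) = sum_S |S| (1 - r) r^(|S| - 1) f^(S)^2 ([mu_mean_level1]),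
    whereas Var(P_t f) = sum_(S nonempty) r^(2 |S|) f^(S)^2 ([var_bonami]).
    Multiplied by exp (2 t) - 1 = (1 - r) (1 + r) / r^2, the latter has
    coefficients (1 - r) (1 + r) r^(2 |S| - 2), which are at most twice
    those of the former since r <= 1 and |S| >= 1. Hence c = 1/4 works. *)

(** * Orthogonality and layers over finite sums *)

(** A weighted Parseval identity. It is stated for a general weight because it
    serves both for the uniform measure on the cube and for the law of the
    random restriction, where the norms [d i] are not all 1. *)
Lemma quadratic_orthogonal (R : realType) (T I : finType) (w : T -> R)
    (phi : I -> T -> R) (d a : I -> R) :
  (forall i j, \sum_x w x * (phi i x * phi j x) = (i == j)%:R * d i) ->
  \sum_x w x * (\sum_i a i * phi i x) ^+ 2 = \sum_i d i * a i ^+ 2.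
Proof.
move=> orth.
under eq_bigr => x _.
  rewrite expr2 big_distrlr mulr_sumr /=.
  under eq_bigr => i _ do rewrite mulr_sumr.
  over.
rewrite exchange_big /=; apply: eq_bigr => i _.
rewrite exchange_big /= (bigD1 i) //= [X in _ + X]big1 => [|j ji].
  transitivity (a i ^+ 2 * \sum_x w x * (phi i x * phi i x)).
    by rewrite addr0 mulr_sumr; apply: eq_bigr => x _; ring.
  by rewrite orth eqxx mul1r mulrC.
transitivity (a i * a j * \sum_x w x * (phi i x * phi j x)).
  by rewrite mulr_sumr; apply: eq_bigr => x _; ring.
by rewrite orth eq_sym (negbTE ji) mul0r mulr0.
Qed.

(** A finite form of the layer-cake formula
    u = lo + integral over c in (lo, hi] of 1_{u >= c}: as [w] has total mass
    zero, the constant drops out and each layer contributes at most [m] per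
    unit of height. Instead of an integral over c, the proof removes the lowest
    layer and recurses on the number of points above the minimum. *)
Lemma layer_cake_le (R : realType) (T : finType) (w : T -> R) (m hi : R) :
  \sum_x w x = 0 -> 0 <= m ->
  forall (u : T -> R) (lo : R), lo <= hi -> (forall x, lo <= u x <= hi) ->
  (forall c, lo < c <= hi -> \sum_x (c <= u x)%R%:R * w x <= m) ->
  \sum_x u x * w x <= (hi - lo) * m.
Proof.
move=> w0 m0 u lo.
have [k] := ubnP #|[pred x | lo < u x]|.
elim: k u lo => // k IHk u lo; rewrite ltnS => card_le lohi ub level.
have [x0 /= ltx0|none] := pickP [pred x | lo < u x]; last first.
  rewrite (eq_bigr (fun x => lo * w x)) => [|x _].
    by rewrite -mulr_sumr w0 mulr0 mulr_ge0 // subr_ge0.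
  have /andP[lox _] := ub x; have /= := none x.
  by rewrite lt_neqAle lox andbT => /negbFE/eqP <-.
(* Raising [lo] to the next value [c] of [u] peels off a layer of height
   [c - lo] supported on {u >= c}. *)
have [x1 /= ltx1 min1] := @arg_minP _ _ _ x0 [pred x | lo < u x] u ltx0.
set c := u x1 in ltx1 min1.
have /andP[_ chi] : lo <= c <= hi := ub x1.
have uE x : u x = Num.max (u x) c - (c - lo) + (c - lo) * (c <= u x)%R%:R.
  have [cu|uc] := leP c (u x); first by rewrite mulr1 subrK.
  have -> : u x = lo.
    apply/eqP; apply: contraTT uc => neq.
    by rewrite -leNgt min1 //= lt_neqAle eq_sym neq; case/andP: (ub x).
  by rewrite mulr0; ring.
have step : \sum_x Num.max (u x) c * w x <= (hi - c) * m.
  apply: IHk => //.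
  - apply: leq_trans card_le; apply: proper_card; apply/properP; split.
      apply/fintype.subsetP => x; rewrite !inE lt_max ltxx orbF => cx.
      exact: lt_trans cx.
    by exists x1; rewrite !inE ?ltx1 // lt_max /c !ltxx.
  - by move=> x; rewrite le_max lexx orbT ge_max chi andbT; case/andP: (ub x).
  - move=> c' /andP[cc' c'hi]; rewrite (eq_bigr (fun x => (c' <= u x)%R%:R * w x)).
      by apply: level; rewrite c'hi (lt_trans ltx1 cc').
    by move=> x _; rewrite le_max [c' <= c]leNgt cc' orbF.
have -> : \sum_x u x * w x = \sum_x Num.max (u x) c * w x
    + (c - lo) * \sum_x (c <= u x)%R%:R * w x.
  transitivity (\sum_x (Num.max (u x) c * w x - (c - lo) * w x
      + (c - lo) * ((c <= u x)%R%:R * w x))).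
    by apply: eq_bigr => x _; rewrite {1}[u x]uE; ring.
  by rewrite !big_split /= sumrN -!mulr_sumr w0 mulr0 subr0.
have levc : \sum_x (c <= u x)%R%:R * w x <= m by apply: level; rewrite ltx1 chi.
have : (c - lo) * \sum_x (c <= u x)%R%:R * w x <= (c - lo) * m.
  by rewrite ler_wpM2l // subr_ge0 ltW.
have -> : (hi - lo) * m = (hi - c) * m + (c - lo) * m by ring.
exact: lerD.
Qed.

(** Beyond height 1/2 the excess |l| - 1/2 is at most l^2 / 2, by
    (|l| - 1)^2 >= 0. *)
Lemma clamp_error (R : realType) (l : R) :
  `|l - Num.max (- 2^-1) (Num.min 2^-1 l)| <= 2^-1 * l ^+ 2.
Proof.
have := sqr_ge0 (l - 1); have := sqr_ge0 (l + 1); have := sqr_ge0 l.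
rewrite ler_norml sqrrB1 sqrrD1 => q0 q1 q2.
have [h1|h1] := leP 2^-1 l; last have [h2|h2] := leP (- 2^-1) l.
- by rewrite max_r; lra.
- by lra.
- by lra.
Qed.

(** * Averages over finite types *)

Section Mean.
Variables (R : realType) (T : finType).
Implicit Types f g : T -> R.

Lemma meanE f : mean f = \sum_x #|T|%:R^-1 * f x.
Proof. by rewrite /mean mulr_suml; apply: eq_bigr => x _; rewrite mulrC. Qed.

Lemma mean_sum (I : finType) (a : I -> R) (F : I -> T -> R) :
  mean (fun x => \sum_i a i * F i x) = \sum_i a i * mean (F i).
Proof.
rewrite /mean exchange_big mulr_suml /=.
by apply: eq_bigr => i _; rewrite -mulr_sumr mulrA.
Qed.

Lemma mean_le f g : (forall x, f x <= g x) -> mean f <= mean g.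
Proof.
by move=> fg; rewrite /mean ler_wpM2r ?invr_ge0 ?ler0n //; apply: ler_sum => x _.
Qed.

Hypothesis T0 : (0 < #|T|)%N.

Lemma mean_cst (a : R) : mean (fun _ : T => a) = a.
Proof.
by rewrite /mean sumr_const -[a *+ _]mulr_natr mulfK // pnatr_eq0 -lt0n.
Qed.

Lemma centered_sum g : \sum_x (g x - mean g) = 0.
Proof.
rewrite big_split sumr_const /= mulNrn -[mean g *+ _]mulr_natr /mean divfK ?subrr //.
by rewrite pnatr_eq0 -lt0n.
Qed.

(** Centring one factor is enough; this makes the covariance with [g] a linear
    functional of zero total mass, as [layer_cake_le] requires. *)
Lemma cov_center f g : cov f g = (\sum_x f x * (g x - mean g)) / #|T|%:R.
Proof.
rewrite /cov {1}/mean; congr (_ / _).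
under eq_bigr => x _ do rewrite mulrBl.
by rewrite big_split sumrN /= -mulr_sumr centered_sum mulr0 subr0.
Qed.
End Mean.

Lemma cube_gt0 n : (0 < #|cube n|)%N.
Proof. by rewrite card_ffun card_bool expn_gt0. Qed.

Lemma mean_bool (R : realType) (h : bool -> R) : mean h = (h true + h false) / 2.
Proof. by rewrite /mean big_bool card_bool. Qed.

Lemma mean_prod (R : realType) n (G : 'I_n -> bool -> R) :
  mean (fun x : cube n => \prod_i G i (x i)) = \prod_i mean (G i).
Proof.
rewrite /mean -(bigA_distr_bigA G) /= big_split /= card_ffun card_ord; congr (_ * _).
by rewrite prodr_const card_ord natrX exprVn.
Qed.

Lemma sum_option_bool (R : realType) (F : option bool -> R) :
  \sum_o F o = F None + F (Some true) + F (Some false).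
Proof.
rewrite (bigD1 None) //= (bigD1 (Some true)) //= (bigD1 (Some false)) //=.
by rewrite big1 ?addr0 ?addrA // => -[[]|].
Qed.

Lemma neq_setP n (S S' : {set 'I_n}) :
  S != S' -> exists j, (j \in S) != (j \in S').
Proof.
move=> neq; apply/existsP; apply: contraNT neq => /existsPn H.
by apply/eqP/setP => j; apply/eqP; move: (H j); rewrite negbK.
Qed.

(** * Walsh expansion *)

Section Walsh.
Variable R : realType.

Definition walsh n (S : {set 'I_n}) (x : cube n) : R :=
  \prod_(i in S) sgnv R (x i).

Lemma walshE n (S : {set 'I_n}) x :
  walsh S x = \prod_i (if i \in S then sgnv R (x i) else 1).
Proof. exact: big_mkcond. Qed.

Lemma walsh1 n (i : 'I_n) x : walsh [set i]%SET x = sgnv R (x i).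
Proof. exact: big_set1. Qed.

Definition fourier n (f : cube n -> R) (S : {set 'I_n}) : R :=
  mean (fun x => f x * walsh S x).

Lemma walsh_orthonormal n (S S' : {set 'I_n}) :
  mean (fun x => walsh S x * walsh S' x) = (S == S')%:R.
Proof.
pose G i b : R :=
  (if i \in S then sgnv R b else 1) * (if i \in S' then sgnv R b else 1).
transitivity (mean (fun x : cube n => \prod_i G i (x i))).
  by congr mean; apply: funext => x; rewrite !walshE -big_split.
rewrite mean_prod.
have GE i : mean (G i) = ((i \in S) == (i \in S'))%:R.
  by rewrite mean_bool /G; case: (i \in S); case: (i \in S') => /=; field.
under eq_bigr => i _ do rewrite GE.
have [<-|/neq_setP[j /negbTE neq]] := eqVneq.
  by rewrite big1 // => i _; rewrite eqxx.
by rewrite (bigD1 j) //= neq mul0r.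
Qed.

Lemma mean_walsh n (S : {set 'I_n}) : mean (@walsh n S) = (S == finset.set0)%:R.
Proof.
rewrite -walsh_orthonormal; congr mean; apply: funext => x.
by rewrite [walsh finset.set0 x]big_set0 mulr1.
Qed.

(** The Walsh functions are also complete, because
    sum_S walsh S y * walsh S x = prod_i (1 + y_i x_i) vanishes unless y = x. *)
Lemma walsh_inversion n (f : cube n -> R) x :
  f x = \sum_S fourier f S * walsh S x.
Proof.
have kernel y : \sum_S walsh S y * walsh S x = (y == x)%:R * #|cube n|%:R.
  transitivity (\prod_i (sgnv R (y i) * sgnv R (x i) + 1)).
    rewrite bigA_distr; apply: eq_bigr => S _; rewrite !walshE -big_split /=.
    by apply: eq_bigr => i _; case: (i \in S); rewrite ?mulr1.
  have [->|neq] := eqVneq y x.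
    rewrite mul1r card_ffun card_bool card_ord natrX.
    rewrite (eq_bigr (fun=> 2%:R)) ?prodr_const ?card_ord // => i _.
    by case: (x i) => /=; ring.
  have [i yxi] : exists i, y i != x i.
    apply/existsP; apply: contraNT neq => /existsPn H; apply/eqP/ffunP => i.
    by apply/eqP; move: (H i); rewrite negbK.
  rewrite (bigD1 i) //= mul0r; move: yxi.
  by case: (y i); case: (x i) => //= _; rewrite ?(mulr1, mul1r) addrC ?subrr mul0r.
under eq_bigr => S _ do rewrite /fourier /mean mulrAC mulr_suml.
rewrite -mulr_suml exchange_big /=.
rewrite (bigD1 x) //= [X in _ + X]big1 => [|y yx].
  under eq_bigr => S _ do rewrite -mulrA.
  by rewrite -mulr_sumr kernel eqxx mul1r addr0 mulfK // pnatr_eq0 -lt0n cube_gt0.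
under eq_bigr => S _ do rewrite -mulrA.
by rewrite -mulr_sumr kernel (negbTE yx) mul0r mulr0.
Qed.

(** The family is indexed through [F] so that the identity covers both full
    expansions and sums over singletons. *)
Lemma parseval n (I : finType) (F : I -> {set 'I_n}) (a : I -> R) :
  injective F ->
  mean (fun x => (\sum_i a i * walsh (F i) x) ^+ 2) = \sum_i a i ^+ 2.
Proof.
move=> injF; rewrite meanE.
rewrite (@quadratic_orthogonal _ _ _ _ (fun i => walsh (F i)) (fun=> 1)) => [|i j].
  by apply: eq_bigr => i _; rewrite mul1r.
by rewrite mulr1 -meanE walsh_orthonormal (inj_eq injF).
Qed.

(** In one variable the semigroup fixes constants and multiplies the sign
    function by exp (- t), so a product of |S| signs is an eigenvector. *)
Lemma bonami_walsh n (t : R) (S : {set 'I_n}) x :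
  bonami t (walsh S) x = expR (- t) ^+ #|S| * walsh S x.
Proof.
pose g i b : R := if i \in S then sgnv R b else 1.
have -> : walsh S = (fun y => \prod_i g i (y i)).
  by apply: funext => y; rewrite walshE.
rewrite tensor_pow_prod -prodr_const [X in _ = X * _]big_mkcond -big_split /=.
apply: eq_bigr => i _; rewrite /bonami1 mean_bool /g.
by case: (i \in S) => /=; case: (x i) => /=; field.
Qed.

Lemma bonami_fourier n (t : R) (f : cube n -> R) x :
  bonami t f x = \sum_S fourier f S * expR (- t) ^+ #|S| * walsh S x.
Proof.
rewrite /bonami /tensor_pow.
under eq_bigr => y _ do rewrite (walsh_inversion f y) mulr_suml.
rewrite exchange_big /=; apply: eq_bigr => S _.
rewrite -mulrA -bonami_walsh mulr_sumr.
by apply: eq_bigr => y _; rewrite mulrA.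
Qed.

Lemma var_bonami n (t : R) (f : cube n -> R) :
  var (bonami t f) =
  \sum_(S | S != finset.set0) fourier f S ^+ 2 * expR (- t) ^+ (2 * #|S|).
Proof.
pose a (S : {set 'I_n}) := fourier f S * expR (- t) ^+ #|S|.
have meanP : mean (bonami t f) = a finset.set0.
  transitivity (mean (fun x => \sum_S a S * walsh S x)).
    by congr mean; apply: funext => x; rewrite bonami_fourier.
  rewrite mean_sum (bigD1 finset.set0) //= mean_walsh eqxx mulr1.
  rewrite big1 ?addr0 // => S /negbTE S0.
  by rewrite mean_walsh S0 mulr0.
transitivity (mean (fun x : cube n =>
    (\sum_S (S != finset.set0)%:R * a S * walsh S x) ^+ 2)).
  rewrite /var /cov; congr mean; apply: funext => x; rewrite -expr2; congr (_ ^+ 2).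
  rewrite meanP bonami_fourier (bigD1 finset.set0) //=.
  rewrite [RHS](bigD1 finset.set0) //= eqxx !mul0r add0r.
  rewrite [walsh finset.set0 x]big_set0 mulr1 addrAC subrr add0r.
  by apply: eq_bigr => S ->; rewrite mul1r.
rewrite (@parseval _ _ id) // [RHS]big_mkcond /=; apply: eq_bigr => S _.
by case: (S != finset.set0); rewrite ?mul0r ?expr0n // mul1r exprMn -exprM mulnC.
Qed.

(** * Random restrictions and the degree-one weight *)

Definition level1 n (g : cube n -> R) : R := \sum_i fourier g [set i]%SET ^+ 2.

(** Restricting walsh S by z leaves a multiple of x_i exactly when i is the only
    free coordinate of S, and the multiple is then the product of the signs z_j
    over j in S other than i. These multiples are orthogonal over z for
    distinct S, with squared norm exp (- s) (1 - exp (- s))^(|S| - 1). *)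
Lemma mu_mean_level1 n (s : R) (f : cube n -> R) :
  mu_mean s (fun z => level1 (restr f z)) =
  \sum_(S : {set 'I_n})
    #|S|%:R * (expR (- s) * (1 - expR (- s)) ^+ #|S|.-1) * fourier f S ^+ 2.
Proof.
set q := expR (- s).
(* [H i S z] is the contribution of walsh S to the coefficient at i. *)
pose H i S z := mean (fun x : cube n => walsh S (oslash z x) * walsh [set i]%SET x).
have restrE i z : fourier (restr f z) [set i]%SET = \sum_S fourier f S * H i S z.
  rewrite -mean_sum /fourier; congr mean; apply: funext => x.
  rewrite /restr (walsh_inversion f) mulr_suml.
  by apply: eq_bigr => S _; rewrite mulrA.
pose h i (S : {set 'I_n}) j (o : option bool) : R :=
  if j == i then (if i \in S then (o == None)%:R else 0)
  else if j \in S then (if o is Some b then sgnv R b else 0) else 1.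
have HE i S z : H i S z = \prod_j h i S j (z j).
  pose G j b : R := (if j \in S then sgnv R (odflt b (z j)) else 1)
    * (if j \in [set i]%SET then sgnv R b else 1).
  transitivity (mean (fun x : cube n => \prod_j G j (x j))).
    congr mean; apply: funext => x; rewrite !walshE -big_split /=.
    by apply: eq_bigr => j _; rewrite /G ffunE; case: (z j).
  rewrite mean_prod; apply: eq_bigr => j _; rewrite mean_bool /G /h inE.
  have [->|_] := eqVneq j i.
    by case: (i \in S); case: (z i) => [[]|] /=; field.
  by case: (j \in S); case: (z j) => [[]|] /=; field.
(* When |S| = 0 the predecessor exponent is harmless: then i is not in S. *)
pose d i (S : {set 'I_n}) : R := (i \in S)%:R * (q * (1 - q) ^+ #|S|.-1).
have orth i S S' :
    \sum_(z : tcube n) (\prod_j mu s (z j)) * (H i S z * H i S' z) = (S == S')%:R * d i S.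
  transitivity (\prod_j \sum_o mu s o * (h i S j o * h i S' j o)).
    rewrite bigA_distr_bigA; apply: eq_bigr => z _.
    by rewrite !HE -!big_split.
  have factor j : \sum_o mu s o * (h i S j o * h i S' j o) =
      if j == i then ((i \in S) && (i \in S'))%:R * q
      else ((j \in S) == (j \in S'))%:R * (if j \in S then 1 - q else 1).
    rewrite sum_option_bool /mu /h -/q; case: eqP => _.
      by case: (i \in S); case: (i \in S') => /=; field.
    by case: (j \in S); case: (j \in S') => /=; field.
  under eq_bigr => j _ do rewrite factor.
  have [<-|/neq_setP[j neq]] := eqVneq; last first.
    rewrite (bigD1 j) //= [X in X * _](_ : _ = 0) ?mul0r //.
    have [ji|_] := eqVneq j i; last by rewrite (negbTE neq) mul0r.
    by move: neq; rewrite ji; case: (i \in S); case: (i \in S') => //= _; rewrite mul0r.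
  rewrite (bigD1 i) //= eqxx andbb mul1r /d.
  have [iS|_] := boolP (i \in S); last by rewrite !mul0r.
  rewrite !mul1r; congr (_ * _).
  rewrite (cardsD1 i S) iS add1n /= -prodr_const [RHS]big_mkcond /= [RHS](bigD1 i) //=.
  rewrite !inE eqxx mul1r; apply: eq_bigr => j ji.
  by rewrite !inE (negbTE ji) eqxx mul1r /=.
rewrite /mu_mean /level1.
under eq_bigr => z _.
  rewrite mulr_sumr; under eq_bigr => i _ do rewrite restrE.
  over.
rewrite exchange_big /=.
under eq_bigr => i _ do rewrite (quadratic_orthogonal _ (orth i)).
rewrite exchange_big /=; apply: eq_bigr => S _; rewrite -mulr_suml /d -mulr_suml.
by congr (_ * _ * _); rewrite -natr_sum -sum1_card [in RHS]big_mkcond.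
Qed.

(** * Half-spaces detect the degree-one weight *)

(** Any clamping height T > 1/4 gives a bound of this kind: the clamped part has
    covariance at most 2 T M(g) with g, and the tail at most W(g) / (4 T). The
    height 1/2 makes the range of the clamp have length one. *)
Lemma level1_le_M n (g : cube n -> R) :
  (forall x, 0 <= g x <= 1) -> level1 g / 2 <= M g.
Proof.
move=> g01; have N0 := cube_gt0 n.
have M_ub A : halfspace R A -> cov (fun x => (x \in A)%:R) g <= M g.
  by move=> hA; apply: (sup_upper_bound (halfspace_cov_has_sup g)); exists A.
pose a i := fourier g [set i]%SET.
pose L (x : cube n) := \sum_i a i * walsh [set i]%SET x.
pose u x : R := Num.max (- 2^-1) (Num.min 2^-1 (L x)).
(* The closed upper half-space {L >= c} is the lower half-space of -L. *)
have halfspace_L c : halfspace R [set x | c <= L x]%SET.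
  exists (\row_i - a i), (- c); apply/setP => x; rewrite !inE.
  rewrite (eq_bigr (fun i => - (a i * walsh [set i]%SET x))) ?sumrN ?lerN2 //.
  by move=> i _; rewrite mxE walsh1; ring.
have M0 : 0 <= M g.
  apply: le_trans (M_ub [set x | 0 <= (0 : R)]%SET _); last first.
    by exists 0, 0; apply/setP => x; rewrite !inE big1 // => i _; rewrite mxE mulr0.
  rewrite cov_center // (eq_bigr (fun x => g x - mean g)) => [|x _].
    by rewrite centered_sum // mul0r.
  by rewrite inE lexx mul1r.
have mg01 : 0 <= mean g <= 1.
  apply/andP; split; [rewrite -(mean_cst N0 0)|rewrite -(mean_cst N0 1)];
    by apply: mean_le => // x; case/andP: (g01 x).
have meanLw : mean (fun x => L x * (g x - mean g)) = level1 g.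
  transitivity (mean (fun x => \sum_i a i * (walsh [set i]%SET x * (g x - mean g)))).
    congr mean; apply: funext => x; rewrite mulr_suml.
    by apply: eq_bigr => i _; rewrite mulrA.
  rewrite mean_sum; apply: eq_bigr => i _; rewrite expr2; congr (_ * _).
  transitivity (fourier g [set i]%SET - mean g * mean (walsh [set i]%SET)).
    rewrite /fourier /mean mulrA -mulrBl mulr_sumr -sumrB; congr (_ / _).
    by apply: eq_bigr => x _; ring.
  by rewrite mean_walsh -cards_eq0 cards1 mulr0 subr0.
have meanL2 : mean (fun x => L x ^+ 2) = level1 g.
  by rewrite parseval //; exact: finset.set1_inj.
have clamp_le : mean (fun x => u x * (g x - mean g)) <= M g.
  have NR0 : 0 < #|cube n|%:R :> R by rewrite ltr0n.
  rewrite /mean ler_pdivrMr //.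
  rewrite (_ : M g * _ = (2^-1 - - 2^-1) * (M g * #|cube n|%:R)); last by field.
  apply: layer_cake_le => [||||c /andP[c1 c2]].
  - exact: centered_sum.
  - by rewrite mulr_ge0 // ltW.
  - by rewrite lerNl; lra.
  - move=> x; rewrite /u le_max lexx ge_max ge_min lexx !andbT /=; lra.
  (* For c in (-1/2, 1/2], clamping does not change the level set {L >= c}. *)
  rewrite -ler_pdivrMr //; apply: le_trans (M_ub _ (halfspace_L c)).
  rewrite cov_center // [X in X / _ <= _](_ : _ =
    \sum_x (x \in [set y | c <= L y]%SET)%:R * (g x - mean g)) //.
  apply: eq_bigr => x _; rewrite inE /u le_max le_min c2 /=.
  by rewrite [c <= - _]leNgt c1.
have tail x : L x * (g x - mean g) <= u x * (g x - mean g) + 2^-1 * L x ^+ 2.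
  have w1 : `|g x - mean g| <= 1.
    by have := g01 x; rewrite ler_norml; move: mg01; lra.
  have Lu : `|L x - u x| <= 2^-1 * L x ^+ 2 by exact: clamp_error.
  rewrite -[X in X * _ <= _](subrK (u x)) mulrDl addrC lerD2l.
  apply: le_trans (ler_norm _) _; rewrite normrM; apply: le_trans Lu.
  exact: ler_piMr.
have : level1 g <= M g + level1 g / 2.
  have split_mean : mean (fun x => u x * (g x - mean g) + 2^-1 * L x ^+ 2)
      = mean (fun x => u x * (g x - mean g)) + mean (fun x => L x ^+ 2) / 2.
    by rewrite {1}/mean big_split -mulr_sumr /= mulrDl -mulrA [2^-1 * _]mulrC.
  by have := mean_le tail; rewrite split_mean meanL2 meanLw; lra.
lra.
Qed.
End Walsh.

(** * Comparison of the Fourier weights *)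

Theorem theorem3p1 (R : realType) :
  exists2 c : R, 0 < c &
    forall (n : nat) (f : cube n -> R) (t : R),
      (1 <= n)%N -> (forall x, 0 <= f x <= 1) -> 0 < t ->
      let s := - ln (1 - expR (- t)) in
      mu_mean s (fun z => M (restr f z)) >=
        c * (expR (2 * t) - 1) * var (bonami t f).
Proof.
exists 4^-1 => [|n f t _ f01 t0]; first by rewrite invr_gt0.
move=> /=; set r := expR (- t); set s := - ln (1 - r).
have r0 : 0 < r by exact: expR_gt0.
have r1 : r < 1 by rewrite /r expR_lt1 oppr_lt0.
have es : expR (- s) = 1 - r by rewrite /s opprK lnK // posrE subr_gt0.
have mu_ge0 o : 0 <= mu s o by case: o => [b|] /=; rewrite /mu es; lra.
have W_le_M : mu_mean s (fun z => level1 (restr f z)) / 2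
    <= mu_mean s (fun z => M (restr f z)).
  rewrite /mu_mean mulr_suml; apply: ler_sum => z _; rewrite -mulrA ler_wpM2l //.
    by apply: prodr_ge0 => i _.
  by apply: level1_le_M => x; exact: f01.
apply: le_trans W_le_M; rewrite mu_mean_level1 es var_bonami -/r subKr.
have e2t : expR (2 * t) = r^-1 ^+ 2.
  by rewrite /r -expRN opprK -expRM_natl.
(* The comparison now holds separately for each S. *)
rewrite e2t mulr_suml mulr_sumr big_mkcond; apply: ler_sum => S _.
have [->|S0] := eqVneq S finset.set0; first by rewrite cards0 !mul0r.
have [k Sk] : exists k, #|S| = k.+1 by exists #|S|.-1; rewrite prednK // card_gt0.
rewrite Sk /=.
have -> : 4^-1 * (r^-1 ^+ 2 - 1) * (fourier f S ^+ 2 * r ^+ (2 * k.+1))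
    = fourier f S ^+ 2 * (4^-1 * (1 - r) * r ^+ k) * ((1 + r) * r ^+ k).
  by rewrite mulnC exprM !exprS expr0; field; rewrite gt_eqF.
have -> : k.+1%:R * ((1 - r) * r ^+ k) * fourier f S ^+ 2 / 2
    = fourier f S ^+ 2 * (4^-1 * (1 - r) * r ^+ k) * (2 * k.+1%:R) by field.
have rk0 : 0 <= r ^+ k by rewrite exprn_ge0 // ltW.
have rk1 : r ^+ k <= 1 by rewrite exprn_ile1 // ltW.
apply: ler_wpM2l.
  by rewrite mulr_ge0 ?sqr_ge0 // mulr_ge0 // mulr_ge0 ?invr_ge0 // subr_ge0 ltW.
have : (1 : R) <= k.+1%:R by rewrite ler1n.
nra.
Qed.
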